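(* Let $p\in\mathcal P^{\delta\times\delta}$ be a symmetric polynomial of degree $d$ such that $\mathcal D_p$ is bounded and convex and $p(0)=I_\delta$. Then there exists a non-zero $q\in\mathcal P^\delta_{[d/2]+1}$, where $[d/2]$ is the largest integer less than or equal to $d/2$, such that $q(X)v=0$ for every $n$ and every $(X,v)\in\widehat{\partial\mathcal D}_p(n)$. In particular, if the graded set $\mathcal D_p$ is bounded and convex, if $p(0)=I_\delta$, and if $p$ is a minimum degree defining polynomial for $\mathcal D_p$, then the degree of $p$ is at most two.
   Context: Fix a positive integer $g$. $\mathcal P$ denotes the free algebra of polynomials with real coefficients in freely noncommuting variables $x=(x_1,\dots,x_g)$, and $\mathcal P^{\delta\times\delta'}$ the $\delta\times\delta'$ matrices over $\mathcal P$. Write $p\in\mathcal P^{\delta\times\delta'}$ as a finite sum $p=\sum_w p_w w$ over words $w$ with real $\delta\times\delta'$ matrices $p_w$; its degree is the maximal length of a word $w$ with $p_w\ne0$. The involution is $p^T=\sum_w p_w^T w^T$, where $w^T$ is the reversed word; $p\in\mathcal P^{\delta\times\delta}$ is symmetric if $p^T=p$. $\mathbb S_n(\mathbb R^g)$ is the set of $g$-tuples $X$ of real symmetric $n\times n$ matrices; $p(X)=\sum_w p_w\otimes w(X)$, where $w(X)=X_{j_1}\cdots X_{j_k}$ for $w=x_{j_1}\cdots x_{j_k}$ and $\emptyset(X)=I_n$; $p(0)=p_\emptyset$. $\mathcal P^\delta_k$ denotes the space of $1\times\delta$ row matrices whose entries are free polynomials of degree at most $k$. For $q=(q_1,\dots,q_\delta)\in\mathcal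 P^\delta_k$, $X\in\mathbb S_n(\mathbb R^g)$ and $v=(v_1,\dots,v_\delta)\in\mathbb R^\delta\otimes\mathbb R^n$ (with $v_j\in\mathbb R^n$), $q(X)v=\sum_jq_j(X)v_j\in\mathbb R^n$. For symmetric $p$ with $p(0)$ invertible, $\mathcal D_p=(\mathcal D_p(n))_n$, where $\mathcal D_p(n)$ is the connected component containing $0$ of $\{X\in\mathbb S_n(\mathbb R^g):p(X)\text{ is invertible}\}$. $\mathcal D_p$ is convex if each $\mathcal D_p(n)$ is convex, and bounded if there is a constant $K$ with $\sum_j\|X_j\|\le K$ for all $n$ and $X\in\mathcal D_p(n)$. $\partial\mathcal D_p(n)$ is the topological boundary of $\mathcal D_p(n)$, and the detailed boundary $\widehat{\partial\mathcal D}_p(n)$ is the set of pairs $(X,v)$ with $X\in\partial\mathcal D_p(n)$, $0\neq v\in\mathbb R^\delta\otimes\mathbb R^n$, and $p(X)v=0$. The symmetric polynomial $p$ of degree $d$ is a minimum degree defining polynomial for $\mathcal D_p$ if the only $q\in\mathcal P^\delta_{d-1}$ satisfying $q(X)v=0$ for every $n$ and every $(X,v)\in\widehat{\partial\mathcal D}_p(n)$ is $q=0$. *)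

(* Defs.v *)
From HB Require Import structures.
From mathcomp Require Import all_boot all_order all_algebra finmap.
From mathcomp Require Import mxtens monalg.
From mathcomp Require Import all_classical all_reals all_analysis.

Set Implicit Arguments.
Unset Strict Implicit.
Unset Printing Implicit Defensive.

Import Order.TTheory GRing.Theory Num.Theory.
Import numFieldNormedType.Exports.
(* [closure] and [connected_component] on ['I_g -> 'M_n] refer to the product
   topology, i.e. to the usual topology of a finite-dimensional space. *)
Import ArrowAsProduct.

Local Open Scope classical_set_scope.
Local Open Scope ring_scope.

(* The variables x_1, ..., x_g are indexed by ['I_g], words by [seq 'I_g]. *)
Notation freepoly R g := {malg R[{fmonom 'I_g}]}.

Section FreePolynomials.
Context {R : realType} {g : nat}.
Implicit Types (w : {fmonom 'I_g}).

Definition word_rev w : {fmonom 'I_g} := FMonom (rev w).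

Definition fp_inv (f : freepoly R g) : freepoly R g :=
  \sum_(w <- msupp f) << f@_w *g word_rev w >>.

Section Matrices.
Context {a b : nat}.
Implicit Types (p : 'M[freepoly R g]_(a, b)).

Definition mxcoef w p : 'M[R]_(a, b) := \matrix_(i, j) (p i j)@_w.

(* the finite set of the words [w] with [mxcoef w p != 0], see [mem_mxsupp] *)
Definition mxsupp p : {fset {fmonom 'I_g}} :=
  \big[fsetU/fset0]_(ij : 'I_a * 'I_b) msupp (p ij.1 ij.2).

(* The zero matrix gets degree 0. *)
Definition mxdeg p : nat := (\max_(w <- mxsupp p) fdeg w)%N.

Definition fpmx_inv p : 'M[freepoly R g]_(b, a) :=
  \matrix_(i, j) fp_inv (p j i).

Lemma mem_mxsupp p w : (w \in mxsupp p) = (mxcoef w p != 0).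
Proof.
apply/idP/idP => [|/eqP nz].
- rewrite /mxsupp; elim/big_rec: _ => [|ij s _ IH]; first by rewrite in_fset0.
  rewrite in_fsetU => /orP[|//]; rewrite -mcoeff_neq0 => /eqP nz.
  by apply/eqP => /matrixP/(_ ij.1 ij.2); rewrite !mxE.
- apply: contra_notT nz => wp; apply/matrixP => i j; rewrite !mxE.
  apply: mcoeff_outdom; apply: contra wp => wij.
  by rewrite /mxsupp (bigD1 (i, j)) //= in_fsetU wij.
Qed.

End Matrices.

Section Evaluation.
Context {n : nat}.
Implicit Types (X : 'I_g -> 'M[R]_n).

Definition word_eval X w : 'M[R]_n := \prod_(j <- w : seq 'I_g) X j.

Definition fp_eval (f : freepoly R g) X : 'M[R]_n :=
  \sum_(w <- msupp f) f@_w *: word_eval X w.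

Definition mxeval {a b} (p : 'M[freepoly R g]_(a, b)) X : 'M[R]_(a * n, b * n) :=
  \sum_(w <- mxsupp p) mxcoef w p *t word_eval X w.

(* The space R^delta (x) R^n is ['cV_(delta * n)], with the index convention
   of [*t]: [tens_comp v j] is the component [v_j] of [v]. *)
Definition tens_comp {delta} (v : 'cV[R]_(delta * n)) (j : 'I_delta) : 'cV[R]_n :=
  \col_i v (mxtens_index (j, i)) 0.

Definition row_apply {delta} (q : 'rV[freepoly R g]_delta) X
    (v : 'cV[R]_(delta * n)) : 'cV[R]_n :=
  \sum_j fp_eval (q 0 j) X *m tens_comp v j.

End Evaluation.
End FreePolynomials.

Section OperatorNorm.
Context {R : realType} {n : nat}.

Definition norm2 (v : 'cV[R]_n) : R := Num.sqrt (\sum_i v i 0 ^+ 2).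

Definition opnorm (A : 'M[R]_n) : R :=
  sup [set norm2 (A *m v) | v in [set v | norm2 v <= 1]].

End OperatorNorm.

Unset Implicit Arguments.

Section Domains.
Context {R : realType} {g delta : nat}.
Implicit Types (p : 'M[freepoly R g]_delta) (q : 'rV[freepoly R g]_delta).

Definition symtuples (n : nat) : set ('I_g -> 'M[R]_n) :=
  [set X | forall j, (X j)^T = X j].

Definition invertibility_set p (n : nat) : set ('I_g -> 'M[R]_n) :=
  [set X | symtuples n X /\ mxeval p X \in unitmx].

Definition domain p (n : nat) : set ('I_g -> 'M[R]_n) :=
  connected_component (invertibility_set p n) (fun=> 0).

Definition domain_convex p : Prop := forall n, convex_set (domain p n).

(* The bound is uniform in the matrix size, hence the operator norm, rather
   than the entrywise norm that ['M_n] carries in the library. *)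
Definition domain_bounded p : Prop :=
  exists K : R, forall n (X : 'I_g -> 'M[R]_n),
    domain p n X -> \sum_j opnorm (X j) <= K.

(* Boundary relative to the space of symmetric tuples, which has empty
   interior among all tuples. *)
Definition domain_boundary p (n : nat) : set ('I_g -> 'M[R]_n) :=
  symtuples n `&` closure (domain p n) `&` closure (symtuples n `\` domain p n).

Definition detailed_boundary p (n : nat) :
    set (('I_g -> 'M[R]_n) * 'cV[R]_(delta * n)) :=
  [set Xv | [/\ domain_boundary p n Xv.1, Xv.2 != 0 & mxeval p Xv.1 *m Xv.2 = 0]].

Definition vanishes_on_boundary p q : Prop :=
  forall n (X : 'I_g -> 'M[R]_n) (v : 'cV[R]_(delta * n)),
    detailed_boundary p n (X, v) -> row_apply q X v = 0.

Definition minimum_degree p : Prop :=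
  forall q, (mxdeg q < mxdeg p)%N -> vanishes_on_boundary p q -> q = 0.

End Domains.

(* Main.v *)
Require Import Defs.
From HB Require Import structures.
From mathcomp Require Import all_boot all_order all_algebra finmap.
From mathcomp Require Import mxtens monalg.
From mathcomp Require Import all_classical all_reals all_analysis.
From mathcomp Require Import ring lra zify.

(* Write d = deg p and k = [d/2]; only d > 2 needs an argument.  If no non-zero
   row of degree at most k+1 vanished on the detailed boundary, direct sums of
   boundary points would give a single (X, v) for which q |-> q(X)v is injective
   in degree at most k+1.  By convexity the closure of the domain is stable
   under X |-> QXQ for orthogonal projections Q, and p is positive semidefinite
   there.  Take Q with kernel spanned by a vector xi orthogonal to all w(X)v_l
   with |w| <= k.  Since d <= 2k+1, <p(QXQ)v, v> = <p(X)v, v> = 0, hence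
   p(QXQ)v = 0.  Pairing p(X)v - p(QXQ)v = 0 with b(X)v_m, where
   |b| = 2k+2-d, leaves only the top degree words w = u r, |r| = k+1:
     sum_(w,i) (p_w)_(l,i) <xi, (u^T b)(X)v_m> <xi, r(X)v_i> = 0.
   By injectivity the numbers <xi, s(X)v_i>, |s| = k+1, can be prescribed at
   will, which forces p_w = 0 for all words w of length d. *)

Set Implicit Arguments.
Unset Strict Implicit.
Unset Printing Implicit Defensive.

Import Order.TTheory GRing.Theory Num.Theory.
Import numFieldNormedType.Exports.
Import ArrowAsProduct.

Local Open Scope classical_set_scope.
Local Open Scope ring_scope.

(** * Positive semidefinite matrices and entrywise continuity *)

Section InnerProduct.
Variable R : realType.

Definition dotp {n} (x y : 'cV[R]_n) : R := (x^T *m y) 0 0.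

Lemma dotpE n (x y : 'cV[R]_n) : dotp x y = \sum_i x i 0 * y i 0.
Proof. by rewrite /dotp mxE; apply: eq_bigr => i _; rewrite mxE. Qed.

Lemma dotpC n (x y : 'cV[R]_n) : dotp x y = dotp y x.
Proof. by rewrite !dotpE; apply: eq_bigr => i _; rewrite mulrC. Qed.

Lemma dotpDr n (x y z : 'cV[R]_n) : dotp x (y + z) = dotp x y + dotp x z.
Proof. by rewrite /dotp mulmxDr mxE. Qed.

Lemma dotpBr n (x y z : 'cV[R]_n) : dotp x (y - z) = dotp x y - dotp x z.
Proof. by rewrite /dotp mulmxBr !mxE. Qed.

Lemma dotpZr n c (x y : 'cV[R]_n) : dotp x (c *: y) = c * dotp x y.
Proof. by rewrite /dotp -scalemxAr mxE. Qed.

Lemma dotp0r n (x : 'cV[R]_n) : dotp x 0 = 0.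
Proof. by rewrite /dotp mulmx0 mxE. Qed.

Lemma dotp_sumr n (x : 'cV[R]_n) (I : Type) (s : seq I) (P : pred I) (y : I -> 'cV_n) :
  dotp x (\sum_(i <- s | P i) y i) = \sum_(i <- s | P i) dotp x (y i).
Proof. by rewrite /dotp mulmx_sumr summxE. Qed.

Lemma dotp_trmx m n (A : 'M[R]_(m, n)) (x : 'cV[R]_m) (y : 'cV_n) :
  dotp x (A *m y) = dotp (A^T *m x) y.
Proof. by rewrite /dotp trmx_mul trmxK mulmxA. Qed.

Lemma dotp_ge0 n (x : 'cV[R]_n) : 0 <= dotp x x.
Proof. by rewrite dotpE sumr_ge0 // => i _; rewrite -expr2 sqr_ge0. Qed.

Lemma dotp_eq0 n (x : 'cV[R]_n) : (dotp x x == 0) = (x == 0).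
Proof.
apply/eqP/eqP => [|->]; last exact: dotp0r.
rewrite dotpE => x0; apply/colP => i; rewrite mxE; apply/eqP.
rewrite -sqrf_eq0 expr2; apply/eqP.
by move/psumr_eq0P: x0; apply=> // j _; rewrite -expr2 sqr_ge0.
Qed.

Definition psdmx {n} (S : 'M[R]_n) := forall x, 0 <= dotp x (S *m x).

Lemma psdmx_CauchySchwarz n (S : 'M[R]_n) x y : S^T = S -> psdmx S ->
  dotp x (S *m y) ^+ 2 <= dotp x (S *m x) * dotp y (S *m y).
Proof.
move=> symS psdS.
have ge0 s t : 0 <= s ^+ 2 * dotp x (S *m x) + 2 * s * t * dotp x (S *m y)
    + t ^+ 2 * dotp y (S *m y).
  have := psdS (s *: x + t *: y).
  rewrite mulmxDr -!scalemxAr !dotpDr !dotpZr ![dotp (_ + _) _]dotpC !dotpDr.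
  rewrite !dotpZr ![dotp (S *m _) _]dotpC [dotp y (S *m x)]dotp_trmx symS.
  rewrite [dotp (S *m y) x]dotpC; congr (_ <= _); ring.
have a0 := psdS x; have c0 := psdS y.
move: (dotp x (S *m x)) (dotp x (S *m y)) (dotp y (S *m y)) a0 c0 ge0.
move=> a b c a0 c0 ge0.
(* These choices give [c(ac - b^2) >= 0], [a(ac - b^2) >= 0] and, when [a = c = 0], [b^2 <= 0]. *)
have := ge0 c (- b); have := ge0 (- b) a; have := ge0 1 (- b).
have [a_gt0|] := ltP 0 a; first by nra.
have [c_gt0|] := ltP 0 c; first by nra.
by nra.
Qed.

(** Cauchy-Schwarz at [x] and [Sx]: the left side is [|Sx|^4], the right side vanishes. *)
Lemma psdmx_ker n (S : 'M[R]_n) x : S^T = S -> psdmx S ->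
  dotp x (S *m x) = 0 -> S *m x = 0.
Proof.
move=> symS psdS xSx0; apply/eqP; rewrite -dotp_eq0 -sqrf_eq0.
rewrite -{1}[in dotp _ _]symS -dotp_trmx eq_le sqr_ge0 andbT.
by have := psdmx_CauchySchwarz x (S *m x) symS psdS; rewrite xSx0 mul0r.
Qed.

Lemma dotp_mulmx_le n (E : 'M[R]_n) (x : 'cV_n) eps :
  (forall i j, `|E i j| <= eps) ->
  `|dotp x (E *m x)| <= eps * n%:R * dotp x x.
Proof.
move=> leE.
(* The bound is spread over the pairs [(i, j)], so that each term is estimated by
   [|ab| <= (a^2 + b^2) / 2]. *)
have ->: eps * n%:R * dotp x x =
    \sum_i \sum_j eps * ((x i 0 * x i 0 + x j 0 * x j 0) / 2).
  transitivity (\sum_i eps / 2 * (n%:R * (x i 0 * x i 0) + dotp x x)).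
    rewrite -mulr_sumr big_split /= -mulr_sumr -dotpE sumr_const card_ord.
    by rewrite -mulr_natl; field.
  apply: eq_bigr => i _; rewrite -mulr_sumr -mulr_suml big_split /=.
  by rewrite sumr_const card_ord -dotpE -mulr_natl; field.
rewrite dotpE (le_trans (ler_norm_sum _ _ _)) // ler_sum // => i _.
rewrite mxE mulr_sumr (le_trans (ler_norm_sum _ _ _)) // ler_sum // => j _.
rewrite !normrM mulrCA ler_pM ?mulr_ge0 //.
have sqr_norm k : x k 0 * x k 0 = `|x k 0| * `|x k 0|.
  by rewrite -normrM ger0_norm // -expr2 sqr_ge0.
rewrite !sqr_norm; have := sqr_ge0 (`|x i 0| - `|x j 0|).
by move: `|x i 0| `|x j 0| => a b; nra.
Qed.

(** Cauchy-Schwarz at [x] and [S^-1 x] gives [|x|^4 <= <x, Sx> <x, S^-1 x>], and the last factor is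
    at most a constant times [|x|^2]. *)
Lemma psdmx_unit_coercive n (S : 'M[R]_n) : S^T = S -> psdmx S -> S \in unitmx ->
  exists2 c, 0 < c & forall x, c * dotp x x <= dotp x (S *m x).
Proof.
move=> symS psdS uS.
pose eps := \sum_i \sum_j `|(invmx S) i j|.
have leeps i j : `|(invmx S) i j| <= eps.
  rewrite /eps (bigD1 i) //= (bigD1 j) //= -addrA lerDl addr_ge0 //.
    by rewrite sumr_ge0.
  by rewrite sumr_ge0 // => ? _; rewrite sumr_ge0.
have eps0 : 0 <= eps by rewrite sumr_ge0 // => ? _; rewrite sumr_ge0.
pose C := eps * n%:R + 1; have C0 : 0 < C by rewrite ltr_wpDl ?mulr_ge0.
exists C^-1 => [|x]; first by rewrite invr_gt0.
have := psdmx_CauchySchwarz x (invmx S *m x) symS psdS.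
rewrite mulKVmx // [dotp (invmx S *m x) _]dotpC.
have /ler_normlP[_] := dotp_mulmx_le x leeps.
have := psdS x; have := dotp_ge0 x.
move: (dotp x x) (dotp x (S *m x)) (dotp x (invmx S *m x)) => a b c a0 b0 lec CS.
have {}lec : c <= C * a by rewrite (le_trans lec) // /C mulrDl mul1r lerDl.
rewrite mulrC ler_pdivrMr //.
have [->|a_neq0] := eqVneq a 0; first by rewrite mulr_ge0 // ltW.
have a_gt0 : 0 < a by rewrite lt_def a_neq0.
rewrite -(ler_pM2r a_gt0) -expr2 (le_trans CS) //.
by rewrite -mulrA ler_wpM2l.
Qed.

Lemma continuous_sum (T : topologicalType) (I : Type) (s : seq I) (F : I -> T -> R) :
  (forall i, continuous (F i)) -> continuous (fun x => \sum_(i <- s) F i x).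
Proof.
move=> contF; apply: (@continuous_big _ _ (@GRing.add R) 0 xpredT) => //.
exact: add_continuous.
Qed.

Lemma continuous_mul (T : topologicalType) (f h : T -> R) :
  continuous f -> continuous h -> continuous (fun x => f x * h x).
Proof. by move=> cf ch x; apply: cvgM; [exact: cf | exact: ch]. Qed.

Lemma continuous_dotp (T : topologicalType) n (S : T -> 'M[R]_n) y z :
  (forall i j, continuous (fun x => S x i j)) ->
  continuous (fun x => dotp y (S x *m z)).
Proof.
move=> contS.
rewrite (_ : (fun _ => _) = fun x => \sum_i \sum_j (y i 0 * z j 0) * S x i j).
  apply: continuous_sum => i; apply: continuous_sum => j.
  by move=> x; apply: cvgM; [exact: cvg_cst | exact: contS].
apply/funext => x; rewrite dotpE; apply: eq_bigr => i _.
by rewrite mxE mulr_sumr; apply: eq_bigr => j _; ring.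
Qed.

Lemma psdmx_closed (T : topologicalType) n (S : T -> 'M[R]_n) :
  (forall i j, continuous (fun x => S x i j)) -> closed [set x | psdmx (S x)].
Proof.
move=> contS.
rewrite (_ : mkset _ = \bigcap_(y in setT)
    ((fun x => dotp y (S x *m y)) @^-1` [set t | 0 <= t])).
  apply: closed_bigI => y _; apply: closed_comp; last exact: closed_ge.
  by move=> x _; exact: continuous_dotp.
apply/seteqP; split => x /= psdS y; first by move=> _; exact: psdS.
exact: (psdS y).
Qed.

(* The positive semidefinite and the coercive matrices of the family are the
   same, so they form a relatively clopen set. *)
Lemma psdmx_connected (T : topologicalType) n (S : T -> 'M[R]_n) (D : set T) x0 :
    connected D -> (forall i j, continuous (fun x => S x i j)) ->
    (forall x, D x -> (S x)^T = S x /\ S x \in unitmx) ->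
    D x0 -> psdmx (S x0) ->
  forall x, D x -> psdmx (S x).
Proof.
move=> connD contS SD Dx0 psd0.
pose coercive := [set x | exists2 c, 0 < c &
  forall y, c * dotp y y <= dotp y (S x *m y)].
pose B := D `&` [set x | psdmx (S x)].
suff BD : B = D by move=> x; rewrite -BD => -[].
apply: connD; first by exists x0.
- exists coercive; last first.
    apply/seteqP; split => x [Dx].
      by move=> psdS; split => //; apply: psdmx_unit_coercive => //; case: (SD x Dx).
    move=> [c c0 leS]; split => // y.
    by rewrite (le_trans _ (leS y)) // mulr_ge0 ?dotp_ge0 // ltW.
  rewrite openE => x [c c0 leS].
  (* Moving every entry by at most [eps] changes the form by at most [c / 2] times [dotp z z], so
     half of the coercivity survives nearby. *)
  pose eps := c / 2 / n.+1%:R.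
  have eps0 : 0 < eps by rewrite !divr_gt0.
  have : \forall y \near x, forall i j, `|S y i j - S x i j| < eps.
    apply: filter_forall => i; apply: filter_forall => j.
    by apply: cvgr_distC_lt => //; exact: contS.
  apply: filterS => y closeS; exists (c / 2) => [|z]; first by rewrite divr_gt0.
  have {}closeS i j : `|(S y - S x) i j| <= eps by rewrite !mxE ltW.
  have /ler_normlP[+ _] := dotp_mulmx_le z closeS.
  rewrite mulmxBl dotpBr opprB => le1; have le2 := leS z.
  have le3 : eps * n%:R * dotp z z <= c / 2 * dotp z z.
    rewrite ler_wpM2r ?dotp_ge0 // /eps -mulrA ler_piMr ?divr_ge0 ?ltW //.
    by rewrite mulrC ltr_pdivrMr // mul1r ltr_nat.
  have ->: c / 2 * dotp z z = c * dotp z z - c / 2 * dotp z z by field.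
  by lra.
- exists [set x | psdmx (S x)] => //.
  exact: psdmx_closed.
Qed.

Lemma continuous_tuple (T : topologicalType) (I : eqType) m
    (F : T -> I -> 'M[R]_m) :
  (forall i a b, continuous (fun x => F x i a b)) -> continuous F.
Proof.
move=> contF x; apply/cvg_sup => i.
have FF : Filter (F @ x) by apply: fmap_filter.
apply/cvg_image.
  by apply/seteqP; split => // A _; exists (fun=> A).
move=> V /= [W nbhsW sWV]; exists [set G | V (G i)].
  have : \forall y \near x, forall a b, W a b (F y i a b).
    by apply: filter_forall => a; apply: filter_forall => b; exact/contF/nbhsW.
  by apply: filterS => y Wy; apply: sWV.
by apply/seteqP; split => [A [G VG <-] //|A VA]; exists (fun=> A).
Qed.

Lemma coord_tuple_continuous (I : eqType) m i a b :
  continuous (fun X : I -> 'M[R]_m => X i a b).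
Proof.
move=> X; apply: (@continuous_comp _ _ _ (fun X : I -> 'M[R]_m => X i) (fun A : 'M[R]_m => A a b)).
  exact: (@proj_continuous I (fun=> 'M[R]_m) i).
exact: coord_continuous.
Qed.

End InnerProduct.

Lemma continuous_closure_sub (T U : topologicalType) (f : T -> U) (A : set T) (B : set U) :
  continuous f -> (forall x, A x -> B (f x)) ->
  forall x, closure A x -> closure B (f x).
Proof.
move=> contf fAB x clAx V nbhsV.
have [y [Ay Vfy]] := clAx _ (contf x _ nbhsV).
by exists (f y); split => //; exact: fAB.
Qed.

(** * Words, transposition and the action of [p(X)] on vectors *)

Section Evaluation.
Context {R : realType} {g : nat}.

Lemma word_revK : involutive (@word_rev g).
Proof. by move=> w; rewrite /word_rev /=; case: w => s; rewrite revK. Qed.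

Lemma mcoeff_fp_inv (f : freepoly R g) w : (fp_inv f)@_w = f@_(word_rev w).
Proof.
rewrite /fp_inv raddf_sum /=.
under eq_bigr => v _ do rewrite mcoeffU (inv_eq word_revK).
have [fw|fw] := boolP (word_rev w \in msupp f).
  rewrite (bigD1_seq (word_rev w)) ?fset_uniq //= eqxx big1 ?addr0 // => v.
  by move/negPf->.
rewrite mcoeff_outdom // big_seq big1 // => v fv.
by case: eqVneq fw => // <-; rewrite fv.
Qed.

Lemma mxcoef_rev a (p : 'M[freepoly R g]_a) w :
  fpmx_inv p = p -> mxcoef (word_rev w) p = (mxcoef w p)^T.
Proof.
by move=> symp; apply/matrixP => i j; rewrite !mxE -{2}symp mxE mcoeff_fp_inv.
Qed.

Lemma sum_mxtens (V : nmodType) a n (F : 'I_(a * n) -> V) :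
  \sum_i F i = \sum_k \sum_j F (mxtens_index (k, j)).
Proof.
rewrite pair_big (reindex (@mxtens_index a n)) /=; last first.
  by exists (@mxtens_unindex a n) => ? _; rewrite (mxtens_indexK, mxtens_unindexK).
by apply: eq_bigr => -[].
Qed.

Section Action.
Context {n : nat}.
Implicit Types (X : 'I_g -> 'M[R]_n).

Definition eval_seq X (s : seq 'I_g) : 'M[R]_n := \prod_(j <- s) X j.

Lemma eval_seq_nil X : eval_seq X [::] = 1%:M.
Proof. by rewrite /eval_seq big_nil. Qed.

Lemma eval_seq_cons X j s : eval_seq X (j :: s) = X j *m eval_seq X s.
Proof. by rewrite /eval_seq big_cons. Qed.

Lemma eval_seq_cat X s t : eval_seq X (s ++ t) = eval_seq X s *m eval_seq X t.
Proof. by rewrite /eval_seq big_cat. Qed.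

Lemma eval_seq_rev X s : symtuples n X -> eval_seq X (rev s) = (eval_seq X s)^T.
Proof.
move=> symX; elim: s => [|j s IH]; first by rewrite eval_seq_nil trmx1.
by rewrite rev_cons -cats1 eval_seq_cat IH !eval_seq_cons eval_seq_nil mulmx1 trmx_mul symX.
Qed.

(** [p(X)] acting on a vector stored as the family of its components, which avoids the index pairing
    of [*t] when [n] changes under direct sums. *)
Definition mx_act {a b} (p : 'M[freepoly R g]_(a, b)) X (u : 'I_b -> 'cV[R]_n)
    (l : 'I_a) : 'cV[R]_n :=
  \sum_(w <- mxsupp p) \sum_k mxcoef w p l k *: (eval_seq X w *m u k).

Lemma tens_comp_mxeval a b (p : 'M[freepoly R g]_(a, b)) X (v : 'cV_(b * n)) l :
  tens_comp (mxeval p X *m v) l = mx_act p X (tens_comp v) l.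
Proof.
apply/colP => i; rewrite mxE /mxeval mulmx_suml !summxE.
apply: eq_bigr => w _; rewrite mxE summxE.
rewrite sum_mxtens; apply: eq_bigr => k _; rewrite [RHS]mxE [X in _ * X]mxE mulr_sumr.
apply: eq_bigr => j _.
by rewrite tensmxE [tens_comp _ _ _ _]mxE mulrA.
Qed.

Lemma row_apply_act b (q : 'rV[freepoly R g]_b) X (v : 'cV_(b * n)) :
  row_apply q X v = mx_act q X (tens_comp v) 0.
Proof.
rewrite /row_apply /mx_act exchange_big /=; apply: eq_bigr => k _.
rewrite /fp_eval mulmx_suml.
rewrite (big_fset_incl _ (B := mxsupp q)) /=.
- by apply: eq_bigr => w _; rewrite mxE -scalemxAl.
- apply/fsubsetP => w; rewrite -mcoeff_neq0 mem_mxsupp => qw.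
  by apply: contra qw => /eqP/matrixP/(_ 0 k); rewrite !mxE => ->.
- by move=> w _ /mcoeff_outdom ->; rewrite scale0r mul0mx.
Qed.

Definition tens_vec {a} (u : 'I_a -> 'cV[R]_n) : 'cV[R]_(a * n) :=
  \col_i u (mxtens_unindex i).1 (mxtens_unindex i).2 0.

Lemma tens_vecK a (u : 'I_a -> 'cV[R]_n) : tens_comp (tens_vec u) = u.
Proof.
by apply/funext => l; apply/colP => i; rewrite !mxE mxtens_indexK.
Qed.

Lemma tens_compP a (x y : 'cV[R]_(a * n)) :
  (forall l, tens_comp x l = tens_comp y l) -> x = y.
Proof.
move=> xy; apply/colP => i; rewrite -(mxtens_unindexK i).
case: (mxtens_unindex i) => l j.
by move/colP: (xy l) => /(_ j); rewrite !mxE.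
Qed.

Lemma tens_comp0 a l : tens_comp (0 : 'cV[R]_(a * n)) l = 0.
Proof. by apply/colP => i; rewrite !mxE. Qed.

Lemma dotp_tens a (x y : 'cV[R]_(a * n)) :
  dotp x y = \sum_l dotp (tens_comp x l) (tens_comp y l).
Proof.
rewrite dotpE sum_mxtens; apply: eq_bigr => l _; rewrite dotpE; apply: eq_bigr => j _.
by rewrite !mxE.
Qed.

Lemma unitmxP m (A : 'M[R]_m) :
  A \in unitmx <-> (forall v : 'cV_m, A *m v = 0 -> v = 0).
Proof.
split=> [uA v Av0|injA]; first by rewrite -(mulKmx uA v) Av0 mulmx0.
rewrite -unitmx_tr -row_free_unit; apply: inj_row_free => v vA.
by apply: trmx_inj; rewrite trmx0; apply: injA; rewrite -[A]trmxK -trmx_mul vA trmx0.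
Qed.

Lemma mxeval_unitP a (p : 'M[freepoly R g]_a) X :
  mxeval p X \in unitmx <->
  (forall u, (forall l, mx_act p X u l = 0) -> forall l, u l = 0).
Proof.
rewrite unitmxP; split=> [injp u pu0 l|injp v pv0].
  rewrite -(tens_vecK u) (injp (tens_vec u)) ?tens_comp0 //.
  by apply: tens_compP => k; rewrite tens_comp_mxeval tens_vecK pu0 tens_comp0.
apply: tens_compP => l; rewrite tens_comp0; apply: injp => k.
by rewrite -tens_comp_mxeval pv0 tens_comp0.
Qed.

(** Transposition sends each term to the term of the reversed word, and symmetry of [p] makes
    reversal a permutation of its support. *)
Lemma mxeval_tr a (p : 'M[freepoly R g]_a) X :
  fpmx_inv p = p -> symtuples n X -> (mxeval p X)^T = mxeval p X.
Proof.
move=> symp symX; rewrite /mxeval raddf_sum /=.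
transitivity (\sum_(w <- [seq word_rev w | w <- mxsupp p]) mxcoef w p *t word_eval X w).
  rewrite big_map; apply: eq_bigr => w _.
  by rewrite trmx_tens mxcoef_rev //; congr (_ *t _); exact/esym/eval_seq_rev.
apply/perm_big/uniq_perm; rewrite ?fset_uniq //.
  by rewrite map_inj_uniq ?fset_uniq //; exact: (inv_inj word_revK).
move=> w; rewrite -[w]word_revK mem_map; last exact: (inv_inj word_revK).
by rewrite !mem_mxsupp [mxcoef (word_rev (word_rev w)) p]mxcoef_rev // trmx_eq0.
Qed.

Lemma continuous_eval_seq s i j :
  continuous (fun X : 'I_g -> 'M[R]_n => eval_seq X s i j).
Proof.
elim: s i j => [|k s IH] i j.
  rewrite (_ : (fun _ => _) = cst (1%:M i j)); first exact: cst_continuous.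
  by apply/funext => X; rewrite eval_seq_nil.
rewrite (_ : (fun _ => _) = fun X => \sum_m X k i m * eval_seq X s m j); last first.
  by apply/funext => X; rewrite eval_seq_cons mxE.
apply: continuous_sum => m; apply: continuous_mul; last exact: IH.
exact: coord_tuple_continuous.
Qed.

Lemma continuous_mxeval a b (p : 'M[freepoly R g]_(a, b)) i j :
  continuous (fun X : 'I_g -> 'M[R]_n => mxeval p X i j).
Proof.
rewrite (_ : (fun _ => _) = fun X => \sum_(w <- mxsupp p)
   mxcoef w p (mxtens_unindex i).1 (mxtens_unindex j).1 *
   eval_seq X w (mxtens_unindex i).2 (mxtens_unindex j).2); last first.
  by apply/funext => X; rewrite summxE; apply: eq_bigr => w _; rewrite mxE.
apply: continuous_sum => w; apply: continuous_mul; first exact: cst_continuous.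
exact: continuous_eval_seq.
Qed.

End Action.

(** Serves where only the empty word survives: at [X = 0], and when a projection kills all other
    words from the left. *)
Lemma sum_mxcoef_nil {V : lmodType R} a (p : 'M[freepoly R g]_a) (x : 'I_a -> V) l :
  mxcoef (FMonom [::]) p = 1%:M ->
  \sum_(w <- mxsupp p) \sum_k mxcoef w p l k *: (if w == FMonom [::] then x k else 0) = x l.
Proof.
move=> p0.
have supp0 : FMonom [::] \in mxsupp p.
  by rewrite mem_mxsupp p0; apply/eqP => /matrixP/(_ l l)/eqP; rewrite !mxE eqxx oner_eq0.
rewrite (bigD1_seq (FMonom [::])) ?fset_uniq //= p0 addrC big1 ?add0r.
  rewrite (bigD1 l) //= big1 ?addr0; first by rewrite mxE eqxx scale1r.
  by move=> k kl; rewrite mxE eq_sym (negPf kl) scale0r.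
by move=> w /negPf ->; rewrite big1 // => k _; rewrite scaler0.
Qed.

Lemma size_mxsupp a b (p : 'M[freepoly R g]_(a, b)) (w : {fmonom 'I_g}) :
  w \in mxsupp p -> (size w <= mxdeg p)%N.
Proof. by move=> wp; rewrite -fdegE; apply: leq_bigmax_seq. Qed.

Lemma mxdeg_leP a b (p : 'M[freepoly R g]_(a, b)) d :
  reflect (forall w : {fmonom 'I_g}, w \in mxsupp p -> (size w <= d)%N) (mxdeg p <= d)%N.
Proof.
apply: (iffP idP) => [led w /size_mxsupp /leq_trans|led]; first exact.
by apply/bigmax_leqP_seq => w wp _; rewrite fdegE led.
Qed.

End Evaluation.

(** * Direct sums of tuples *)

Section DirectSum.
Context {R : realType} {g : nat}.

Definition dsum_tuple {m n} (X : 'I_g -> 'M[R]_m) (Y : 'I_g -> 'M[R]_n) j : 'M[R]_(m + n) :=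
  block_mx (X j) 0 0 (Y j).

Lemma dsum_tuple0 m n :
  dsum_tuple (fun=> 0) (fun=> 0) = fun=> 0 :> 'M[R]_(m + n).
Proof. by apply/funext => j; rewrite /dsum_tuple block_mx0. Qed.

Lemma continuous_dsum_tuple (T : topologicalType) m n
    (F : T -> 'I_g -> 'M[R]_m) (G : T -> 'I_g -> 'M[R]_n) :
  (forall j a b, continuous (fun x => F x j a b)) ->
  (forall j a b, continuous (fun x => G x j a b)) ->
  continuous (fun x => dsum_tuple (F x) (G x)).
Proof.
move=> contF contG; apply: continuous_tuple => j a b; rewrite /dsum_tuple.
case: (split_ordP a) => a' ->; case: (split_ordP b) => b' ->.
- by under eq_fun do rewrite block_mxEul; exact: contF.
- by under eq_fun do rewrite block_mxEur mxE; exact: cst_continuous.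
- by under eq_fun do rewrite block_mxEdl mxE; exact: cst_continuous.
- by under eq_fun do rewrite block_mxEdr; exact: contG.
Qed.

Lemma eval_seq_dsum m n (X : 'I_g -> 'M[R]_m) (Y : 'I_g -> 'M[R]_n) s :
  eval_seq (dsum_tuple X Y) s = block_mx (eval_seq X s) 0 0 (eval_seq Y s).
Proof.
elim: s => [|j s IH]; first by rewrite !eval_seq_nil -scalar_mx_block.
rewrite !eval_seq_cons IH /dsum_tuple mulmx_block.
by rewrite !mul0mx !mulmx0 !addr0 !add0r.
Qed.

Lemma mx_act_dsum a b (p : 'M[freepoly R g]_(a, b)) m n
    (X : 'I_g -> 'M[R]_m) (Y : 'I_g -> 'M[R]_n) u v l :
  mx_act p (dsum_tuple X Y) (fun k => col_mx (u k) (v k)) l =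
  col_mx (mx_act p X u l) (mx_act p Y v l).
Proof.
rewrite /mx_act -[RHS]vsubmxK col_mxKu col_mxKd.
transitivity (\sum_(w <- mxsupp p) \sum_k
   col_mx (mxcoef w p l k *: (eval_seq X w *m u k)) (mxcoef w p l k *: (eval_seq Y w *m v k))).
  apply: eq_bigr => w _; apply: eq_bigr => k _.
  by rewrite eval_seq_dsum mul_block_col !mul0mx addr0 add0r scale_col_mx.
rewrite -[LHS]vsubmxK !raddf_sum /=; congr col_mx.
  by apply: eq_bigr => w _; rewrite raddf_sum; apply: eq_bigr => k _; rewrite /= col_mxKu.
by apply: eq_bigr => w _; rewrite raddf_sum; apply: eq_bigr => k _; rewrite /= col_mxKd.
Qed.

End DirectSum.

(** * Stability of the domain and of its closure; positivity *)

Section Domain.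
Context {R : realType} {g delta : nat}.
Variable p : 'M[freepoly R g]_delta.
Hypothesis p_sym : fpmx_inv p = p.
Hypothesis p_at0 : mxcoef (FMonom [::]) p = 1%:M.

Lemma eval_seq0 n (w : {fmonom 'I_g}) :
  eval_seq (fun=> 0 : 'M[R]_n) w = if w == FMonom [::] then 1%:M else 0.
Proof.
by case: w => -[|j s]; rewrite ?eval_seq_nil ?eval_seq_cons ?mul0mx.
Qed.

Lemma mx_act0 n (u : 'I_delta -> 'cV[R]_n) : mx_act p (fun=> 0) u = u.
Proof.
apply/funext => l; rewrite -[RHS](sum_mxcoef_nil u l p_at0).
apply: eq_bigr => w _; apply: eq_bigr => k _; rewrite eval_seq0.
by case: ifP => _; rewrite ?mul1mx ?mul0mx.
Qed.

Lemma mxeval0 n : mxeval p (fun=> 0 : 'M[R]_n) = 1%:M.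
Proof.
apply/matrixP => i j.
have -> : mxeval p (fun=> 0) i j = (mxeval p (fun=> 0) *m (delta_mx j 0 : 'cV_(delta * n))) i 0.
  by rewrite -colE mxE.
suff -> : mxeval p (fun=> 0) *m (delta_mx j 0 : 'cV_(delta * n)) = delta_mx j 0.
  by rewrite !mxE eqxx andbT.
by apply: tens_compP => l; rewrite tens_comp_mxeval mx_act0.
Qed.

Lemma domain0 n : domain p n (fun=> 0).
Proof.
apply: connected_component_refl; split; first by move=> j; rewrite trmx0.
by rewrite mxeval0 unitmx1.
Qed.

Lemma domain_invertible n X : domain p n X -> invertibility_set p n X.
Proof. exact: connected_component_sub. Qed.

(** The image of [domain p m] is connected, lies in the invertibility set and contains [F 0], a
    point of the component of 0. *)
Lemma domain_image m n (F : ('I_g -> 'M[R]_m) -> ('I_g -> 'M[R]_n)) :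
    continuous F -> domain p n (F (fun=> 0)) ->
    (forall X, domain p m X -> invertibility_set p n (F X)) ->
  forall X, domain p m X -> domain p n (F X).
Proof.
move=> contF F0 invF X DX; apply: (connected_component_trans F0).
have : (F @` domain p m) (F X) by exists X.
apply: connected_component_max.
- by exists (fun=> 0) => //; exact: domain0.
- by move=> _ [Y DY <-]; exact: invF.
- apply: connected_continuous_connected; first exact: component_connected.
  exact: continuous_subspaceT.
Qed.

Lemma continuous_conj n (Q : 'M[R]_n) :
  continuous (fun (X : 'I_g -> 'M[R]_n) j => Q *m X j *m Q).
Proof.
apply: continuous_tuple => j a b.
rewrite (_ : (fun _ => _) = fun X : 'I_g -> 'M[R]_n =>
    \sum_l (\sum_k Q a k * X j k l) * Q l b); last first.
  by apply/funext => X; rewrite mxE; apply: eq_bigr => l _; rewrite mxE.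
apply: continuous_sum => l; apply: continuous_mul; last exact: cst_continuous.
apply: continuous_sum => k; apply: continuous_mul; first exact: cst_continuous.
exact: coord_tuple_continuous.
Qed.

Lemma symtuples_conj n (Q : 'M[R]_n) X : Q^T = Q -> symtuples n X ->
  symtuples n (fun j : 'I_g => Q *m X j *m Q).
Proof. by move=> symQ symX j; rewrite !trmx_mul symQ symX mulmxA. Qed.

Lemma conj0 n (Q : 'M[R]_n) : (fun j : 'I_g => Q *m 0 *m Q) = fun=> 0.
Proof. by apply/funext => j; rewrite mulmx0 mul0mx. Qed.

Lemma eval_seq_conj n (U : 'M[R]_n) (X : 'I_g -> 'M[R]_n) s : U *m U = 1%:M ->
  eval_seq (fun j => U *m X j *m U) s = U *m eval_seq X s *m U.
Proof.
move=> UU; elim: s => [|j s IH]; first by rewrite !eval_seq_nil mulmx1 UU.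
by rewrite !eval_seq_cons IH !mulmxA -(mulmxA _ U U) UU mulmx1.
Qed.

Lemma mx_act_mulmx a b (q : 'M[freepoly R g]_(a, b)) n (A : 'M[R]_n) X u l :
  A *m mx_act q X u l =
  \sum_(w <- mxsupp q) \sum_k mxcoef w q l k *: (A *m eval_seq X w *m u k).
Proof.
rewrite mulmx_sumr; apply: eq_bigr => w _; rewrite mulmx_sumr.
by apply: eq_bigr => k _; rewrite -scalemxAr mulmxA.
Qed.

(** [p(UXU)] is [p(X)] conjugated by the involution applying [U] to every component, hence is again
    invertible. *)
Lemma domain_conj n (U : 'M[R]_n) X : U^T = U -> U *m U = 1%:M ->
  domain p n X -> domain p n (fun j => U *m X j *m U).
Proof.
move=> symU UU; move: X.
apply: domain_image; first exact: continuous_conj.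
  by rewrite conj0; exact: domain0.
move=> X /domain_invertible[symX uX]; split; first exact: symtuples_conj.
apply/mxeval_unitP => u pu0 l.
have : U *m u l = 0.
  move/mxeval_unitP: uX => /(_ (fun k => U *m u k)); apply => k.
  rewrite -(mul1mx (mx_act _ _ _ _)) -{1}UU -mulmxA mx_act_mulmx.
  transitivity (U *m mx_act p (fun j => U *m X j *m U) u k); last by rewrite pu0 mulmx0.
  congr (_ *m _).
  rewrite /mx_act; apply: eq_bigr => w _; apply: eq_bigr => i _; congr (_ *: _).
  by rewrite eval_seq_conj // mulmxA.
by move/(congr1 (mulmx U)); rewrite mulmxA UU mul1mx mulmx0.
Qed.

(* With [U = 2Q - 1], the midpoint of [X] and [UXU] commutes with [Q] and agrees
   with [QXQ] on the range of [Q]. *)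
Lemma domain_compress n (Q : 'M[R]_n) X : domain_convex p ->
  Q^T = Q -> Q *m Q = Q ->
  domain p n X -> domain p n (fun j => Q *m X j *m Q).
Proof.
move=> convD symQ QQ; move: X.
apply: domain_image; first exact: continuous_conj.
  by rewrite conj0; exact: domain0.
move=> X DX.
pose U : 'M[R]_n := 2 *: Q - 1%:M.
have symU : U^T = U by rewrite /U linearB /= linearZ /= symQ trmx1.
have UU : U *m U = 1%:M.
  rewrite /U mulmxBl mul1mx mulmxBr mulmx1 -scalemxAl -scalemxAr QQ.
  by apply/matrixP => i j; rewrite !mxE; ring.
pose M j := 2^-1 *: X j + 2^-1 *: (U *m X j *m U).
have DM : domain p n M.
  have half01 : 0 <= (2^-1 : R) <= 1 by lra.
  have := convD n X (fun j => U *m X j *m U) (Itv01 (andP half01).1 (andP half01).2).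
  rewrite !inE; move=> /(_ DX (domain_conj symU UU DX)); congr (domain p n _).
  apply/funext => j; rewrite /M; congr (_ + _ *: _).
  by have : 1 - 2^-1 = 2^-1 :> R by field.
have QU : Q *m U = Q.
  rewrite /U mulmxBr mulmx1 -scalemxAr QQ.
  by apply/matrixP => i j; rewrite !mxE; ring.
have UQ : U *m Q = Q by rewrite -[RHS]symQ -[in RHS]QU trmx_mul symQ symU.
have QM j : Q *m M j = Q *m X j *m Q.
  rewrite /M mulmxDr -!scalemxAr !mulmxA QU /U mulmxBr mulmx1 -scalemxAr.
  by apply/matrixP => a b; rewrite !mxE; field.
have MQ j : M j *m Q = Q *m X j *m Q.
  rewrite /M mulmxDl -!scalemxAl -!mulmxA UQ /U mulmxBl mul1mx -scalemxAl.
  by apply/matrixP => a b; rewrite !mxE; field.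
have [symX _] := domain_invertible DX.
split; first exact: symtuples_conj.
have [_ /mxeval_unitP injM] := domain_invertible DM.
apply/mxeval_unitP => u pu0.
(* Every non-empty word in [QXQ] starts with [Q] and is killed by [C], so [C] applied to [p(QXQ)u]
   leaves [C u]. A kernel vector thus has its components in the range of [Q], where [p(QXQ)] agrees
   with the injective [p(M)]. *)
pose C := 1%:M - Q.
have CQ : C *m Q = 0 by rewrite /C mulmxBl mul1mx QQ subrr.
have evalC (w : {fmonom 'I_g}) :
    C *m eval_seq (fun j => Q *m X j *m Q) w = if w == FMonom [::] then C else 0.
  case: w => -[|j s]; first by rewrite eval_seq_nil mulmx1.
  by rewrite eval_seq_cons !mulmxA CQ !mul0mx.
have evalQ s : eval_seq (fun j => Q *m X j *m Q) s *m Q = eval_seq M s *m Q.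
  elim: s => [|j s IH]; first by rewrite !eval_seq_nil.
  rewrite !eval_seq_cons -!mulmxA IH.
  have -> : eval_seq M s *m Q = Q *m (eval_seq M s *m Q).
    elim: s {IH} => [|i s IH]; first by rewrite eval_seq_nil mul1mx QQ.
    by rewrite eval_seq_cons -!mulmxA {1}IH [LHS]mulmxA MQ [RHS]mulmxA QM.
  by rewrite !mulmxA MQ -(mulmxA (Q *m X j) Q Q) QQ.
have Cu l : C *m u l = 0.
  rewrite -(sum_mxcoef_nil (fun k => C *m u k) l p_at0).
  transitivity (C *m mx_act p (fun j => Q *m X j *m Q) u l); last by rewrite pu0 mulmx0.
  rewrite mx_act_mulmx.
  apply: eq_bigr => w _; apply: eq_bigr => k _; rewrite evalC.
  by case: ifP => _; rewrite ?mul0mx.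
have uQ l : u l = Q *m u l.
  by apply/eqP; rewrite -subr_eq0 -{1}[u l]mul1mx -mulmxBl Cu.
apply: injM => l; rewrite -[RHS](pu0 l); apply: eq_bigr => w _; apply: eq_bigr => k _.
by rewrite uQ !mulmxA evalQ.
Qed.

Lemma domain_dsum m n X Y : domain p m X -> domain p n Y ->
  domain p (m + n) (dsum_tuple X Y).
Proof.
have inv_dsum X' Y' : domain p m X' -> domain p n Y' ->
    invertibility_set p (m + n) (dsum_tuple X' Y').
  move=> /domain_invertible[symX /mxeval_unitP uX].
  move=> /domain_invertible[symY /mxeval_unitP uY]; split.
    by move=> j; rewrite /dsum_tuple tr_block_mx symX symY !trmx0.
  apply/mxeval_unitP => u pu0 l.
  have pu0' k : col_mx (mx_act p X' (fun k => usubmx (u k)) k)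
      (mx_act p Y' (fun k => dsubmx (u k)) k) = 0.
    rewrite -mx_act_dsum -[RHS](pu0 k); congr mx_act.
    by apply/funext => i; rewrite vsubmxK.
  rewrite -[u l]vsubmxK (uX (fun k => usubmx (u k))) ?(uY (fun k => dsubmx (u k))) ?col_mx0 // => k.
    by have /(congr1 dsubmx) := pu0' k; rewrite col_mxKd linear0.
  by have /(congr1 usubmx) := pu0' k; rewrite col_mxKu linear0.
(* One summand moves at a time: the base point [X, 0] is itself reached from [0, 0]. *)
move=> DX; move: Y; apply: domain_image.
- by apply: continuous_dsum_tuple => j a b; [exact: cst_continuous|exact: coord_tuple_continuous].
- move: X DX; apply: domain_image.
  + by apply: continuous_dsum_tuple => j a b; [exact: coord_tuple_continuous|exact: cst_continuous].
  + by rewrite dsum_tuple0; exact: domain0.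
  + by move=> X DX; apply: inv_dsum => //; exact: domain0.
- by move=> Y DY; exact: inv_dsum.
Qed.

Lemma closure_domain_compress n (Q : 'M[R]_n) X : domain_convex p ->
  Q^T = Q -> Q *m Q = Q ->
  closure (domain p n) X -> closure (domain p n) (fun j => Q *m X j *m Q).
Proof.
move=> convD symQ QQ; apply: (continuous_closure_sub (f := fun X j => Q *m X j *m Q)).
  exact: continuous_conj.
by move=> Y; exact: domain_compress.
Qed.

Lemma closure_domain_dsum m n X Y : closure (domain p m) X -> closure (domain p n) Y ->
  closure (domain p (m + n)) (dsum_tuple X Y).
Proof.
move=> clX clY.
move/closure_id: (@closed_closure _ (domain p (m + n))) => ->.
move: Y clY; apply: continuous_closure_sub => [|Y DY].
  by apply: continuous_dsum_tuple => j a b; [exact: cst_continuous|exact: coord_tuple_continuous].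
apply: (continuous_closure_sub (f := dsum_tuple^~ Y)) clX => [|{}X DX].
  by apply: continuous_dsum_tuple => j a b; [exact: coord_tuple_continuous|exact: cst_continuous].
exact: domain_dsum.
Qed.

(** [p(0) = 1] is positive, positivity spreads over the connected domain because [p(X)] stays
    symmetric and invertible there, and it is a closed condition. *)
Lemma closure_domain_psd n X : closure (domain p n) X -> psdmx (mxeval p X).
Proof.
have cont_p := @continuous_mxeval R g n _ _ p.
suff sub : domain p n `<=` [set X | psdmx (mxeval p X)].
  by move/(closureS sub); rewrite -(iffLR (closure_id _) (psdmx_closed cont_p)).
apply: (psdmx_connected (@component_connected _ _ _) cont_p _ (domain0 n)).
  by move=> Y /domain_invertible[symY uY]; split => //; exact: mxeval_tr.
by rewrite mxeval0 => x; rewrite mul1mx dotp_ge0.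
Qed.

(** A singular [p(X)] already excludes [X] from the domain, so membership in the closure of the
    complement is automatic. *)
Lemma detailed_boundaryP n X (v : 'cV[R]_(delta * n)) :
  detailed_boundary p n (X, v) <->
  [/\ symtuples n X, closure (domain p n) X, v != 0 & mxeval p X *m v = 0].
Proof.
split=> [[/= [[symX clX] _] v0 pv]|[symX clX v0 pv]] //.
split => //=; split => //; apply: subset_closure; split => //.
move=> /domain_invertible[_ /unitmxP/(_ v pv) v_eq0].
by rewrite v_eq0 eqxx in v0.
Qed.

End Domain.

(** * Comparison of [X] with its compression [QXQ] on short words *)

Section Compression.
Context {R : realType} {g delta n k : nat}.
Variables (X : 'I_g -> 'M[R]_n) (v : 'I_delta -> 'cV[R]_n) (Q : 'M[R]_n).
Hypothesis symX : symtuples n X.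
Hypothesis symQ : Q^T = Q.
Hypothesis QQ : Q *m Q = Q.
Hypothesis Qfix : forall s l, (size s <= k)%N ->
  Q *m (eval_seq X s *m v l) = eval_seq X s *m v l.

Let XQ j := Q *m X j *m Q.

Lemma eval_seq_compress s l : (size s <= k)%N ->
  eval_seq XQ s *m v l = eval_seq X s *m v l.
Proof.
elim: s => [|j s IH] /= sk; first by rewrite !eval_seq_nil.
rewrite !eval_seq_cons -!mulmxA IH ?(ltnW sk) // Qfix ?(ltnW sk) //.
by rewrite [X j *m _]mulmxA -eval_seq_cons Qfix.
Qed.

(** At length [k.+1] the inner copies of [Q] still act on vectors that [Q] fixes; only the leftmost
    one is felt. *)
Lemma eval_seq_compressS s l : (size s <= k.+1)%N ->
  eval_seq XQ s *m v l = Q *m (eval_seq X s *m v l).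
Proof.
case: s => [_|j s /= sk]; first by rewrite Qfix // !eval_seq_nil.
by rewrite !eval_seq_cons -!mulmxA eval_seq_compress // Qfix.
Qed.

Lemma dotp_eval_rev (Y : 'I_g -> 'M[R]_n) a b (x y : 'cV_n) : symtuples n Y ->
  dotp x (eval_seq Y (rev a ++ b) *m y) = dotp (eval_seq Y a *m x) (eval_seq Y b *m y).
Proof.
by move=> symY; rewrite eval_seq_cat -mulmxA dotp_trmx eval_seq_rev // trmxK.
Qed.

Lemma dotp_compress a b l m : (size a <= k.+1)%N -> (size b <= k.+1)%N ->
  dotp (v l) (eval_seq XQ (rev a ++ b) *m v m) =
  dotp (eval_seq X a *m v l) (Q *m (eval_seq X b *m v m)).
Proof.
move=> ak bk; rewrite dotp_eval_rev; last exact: symtuples_conj.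
by rewrite !eval_seq_compressS // dotp_trmx symQ mulmxA QQ [RHS]dotp_trmx symQ.
Qed.

Lemma dotp_compress_low s l m : (size s <= k + k.+1)%N ->
  dotp (v l) (eval_seq XQ s *m v m) = dotp (v l) (eval_seq X s *m v m).
Proof.
(* The right part takes up to [k.+1] letters and leaves at most [k] to the left part (none for short
   [s], by truncated subtraction), so [Q] fixes the left vector. *)
move=> sk; rewrite -(cat_take_drop (size s - k.+1) s) -[take _ s]revK.
have ak : (size (rev (take (size s - k.+1) s)) <= k)%N.
  by rewrite size_rev size_take_min; lia.
rewrite dotp_compress ?dotp_eval_rev //; last by rewrite size_drop; lia.
  by rewrite dotp_trmx symQ Qfix.
exact: leqW.
Qed.

(** All words of [p] are too short to distinguish [X] from [XQ] in the quadratic form at [v], so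
    [<p(QXQ)v, v>] vanishes. Convexity keeps [QXQ] in the closure of the domain, where [p] is
    positive semidefinite, so [v] lies in the kernel. *)
Lemma mx_act_compress (p : 'M[freepoly R g]_delta) :
    fpmx_inv p = p -> mxcoef (FMonom [::]) p = 1%:M -> domain_convex p ->
    (mxdeg p <= k + k.+1)%N ->
    closure (domain p n) X -> (forall l, mx_act p X v l = 0) ->
  forall l, mx_act p XQ v l = 0.
Proof.
move=> p_sym p_at0 convD pk clX pv0 l.
have clXQ : closure (domain p n) XQ by exact: closure_domain_compress.
have symXQ : symtuples n XQ by exact: symtuples_conj.
have : mxeval p XQ *m tens_vec v = 0.
  apply: psdmx_ker; [exact: mxeval_tr | exact: closure_domain_psd |].
  rewrite dotp_tens big1 // => m _; rewrite tens_comp_mxeval tens_vecK.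
  transitivity (dotp (v m) (mx_act p X v m)); last by rewrite pv0 dotp0r.
  rewrite !dotp_sumr big_seq [RHS]big_seq; apply: eq_bigr => w wp.
  rewrite !dotp_sumr; apply: eq_bigr => i _; rewrite !dotpZr; congr (_ * _).
  by rewrite dotp_compress_low // (leq_trans (size_mxsupp wp)).
by move/(congr1 (fun x => tens_comp x l)); rewrite tens_comp_mxeval tens_vecK tens_comp0.
Qed.

(* Pairing [p(X)v] and [p(QXQ)v] with [b(X)v] only sees words of length at most
   [2k+2], and among these only the words of length exactly [2k+2] can tell [X]
   from its compression. *)
Lemma compress_defect (p : 'M[freepoly R g]_delta) b l m :
    fpmx_inv p = p -> mxcoef (FMonom [::]) p = 1%:M -> domain_convex p ->
    (mxdeg p <= k + k.+1)%N -> (size b <= k)%N -> (mxdeg p + size b = k.+1 + k.+1)%N ->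
    closure (domain p n) X -> (forall l, mx_act p X v l = 0) ->
  \sum_(w <- mxsupp p | size w == mxdeg p) \sum_i mxcoef w p l i *
    dotp (eval_seq X (rev (take (mxdeg p - k.+1) w) ++ b) *m v m)
      ((1%:M - Q) *m (eval_seq X (drop (mxdeg p - k.+1) w) *m v i)) = 0.
Proof.
move=> p_sym p_at0 convD pk bk pbk clX pv0.
have symXQ : symtuples n XQ by exact: symtuples_conj.
have pQv0 := mx_act_compress p_sym p_at0 convD pk clX pv0.
have : dotp (eval_seq X b *m v m) (mx_act p X v l) - 
       dotp (eval_seq XQ b *m v m) (mx_act p XQ v l) = 0.
  by rewrite pv0 pQv0 !dotp0r subrr.
move=> defect0; rewrite -[RHS]defect0 !dotp_sumr -sumrB.
rewrite [LHS]big_mkcond /= [LHS]big_seq [RHS]big_seq.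
apply: eq_bigr => w wp; rewrite !dotp_sumr -sumrB.
have wd := size_mxsupp wp.
case: ifP => [/eqP wdeg|/negbT wdeg].
  apply: eq_bigr => i _; rewrite !dotpZr -mulrBr; congr (_ * _).
  rewrite -!dotp_eval_rev //.
  (* A top degree word is recut into two halves of length exactly [k.+1], which is possible as
     [mxdeg p + size b] is twice [k.+1]. *)
  have -> : rev b ++ w = rev (rev (take (mxdeg p - k.+1) w) ++ b) ++ drop (mxdeg p - k.+1) w.
    by rewrite rev_cat revK -catA cat_take_drop.
  rewrite dotp_compress ?dotp_eval_rev // ?mulmxBl ?mul1mx ?dotpBr //.
    by rewrite size_cat size_rev size_take_min wdeg; move: (mxdeg p) (size b) pbk bk => D B; lia.
  by rewrite size_drop wdeg; move: (mxdeg p) pk => D; lia.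
(* For a shorter [w], the word [rev b ++ w] has at most [k + k.+1] letters, and the two pairings
   agree. *)
rewrite big1 // => i _; rewrite !dotpZr -!dotp_eval_rev // dotp_compress_low ?subrr //.
move: wd; rewrite leq_eqVlt (negPf wdeg) /= => wd.
by rewrite size_cat size_rev; move: (mxdeg p) (size b) (size w) pbk wd => D B W; lia.
Qed.

End Compression.

(** * The quadratic relation on the top coefficients *)

Section TopRelation.
Context {R : realType} {g delta n k : nat}.
Variables (X : 'I_g -> 'M[R]_n) (v : 'I_delta -> 'cV[R]_n).

(** For the orthogonal projection [Q] with kernel spanned by [xi], [1 - Q] has rank one, so each
    pairing in [compress_defect] is a product of two pairings with [xi], divided by [dotp xi xi]. *)
Lemma top_relation (p : 'M[freepoly R g]_delta) (xi : 'cV[R]_n) b l m :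
    symtuples n X ->
    fpmx_inv p = p -> mxcoef (FMonom [::]) p = 1%:M -> domain_convex p ->
    (mxdeg p <= k + k.+1)%N -> (size b <= k)%N -> (mxdeg p + size b = k.+1 + k.+1)%N ->
    closure (domain p n) X -> (forall l, mx_act p X v l = 0) ->
    (forall s l, (size s <= k)%N -> dotp xi (eval_seq X s *m v l) = 0) ->
  \sum_(w <- mxsupp p | size w == mxdeg p) \sum_i mxcoef w p l i *
    (dotp xi (eval_seq X (rev (take (mxdeg p - k.+1) w) ++ b) *m v m) *
     dotp xi (eval_seq X (drop (mxdeg p - k.+1) w) *m v i)) = 0.
Proof.
move=> symX p_sym p_at0 convD pk bk pbk clX pv0 xi_orth.
have [->|xi_neq0] := eqVneq xi 0.
  rewrite big1 // => w _; rewrite big1 // => i _.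
  by rewrite dotpC dotp0r mul0r mulr0.
have N0 : dotp xi xi != 0 by rewrite dotp_eq0.
pose Q : 'M[R]_n := 1%:M - (dotp xi xi)^-1 *: (xi *m xi^T).
have CQ : 1%:M - Q = (dotp xi xi)^-1 *: (xi *m xi^T) by rewrite /Q subKr.
have mul_xi x : xi *m xi^T *m x = dotp xi x *: xi.
  by rewrite -mulmxA [xi^T *m x]mx11_scalar mul_mx_scalar.
have symQ : Q^T = Q by rewrite /Q linearB /= linearZ /= trmx1 trmx_mul trmxK.
have QQ : Q *m Q = Q.
  rewrite {2}/Q mulmxBr mulmx1 -scalemxAr {2}/Q mulmxBl mul1mx -scalemxAl.
  by rewrite mulmxA mul_xi -scalemxAl scalerA mulVf // scale1r subrr scaler0 subr0.
have Qfix s i : (size s <= k)%N ->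
    Q *m (eval_seq X s *m v i) = eval_seq X s *m v i.
  by move=> sk; rewrite /Q mulmxBl mul1mx -scalemxAl mul_xi xi_orth // scale0r scaler0 subr0.
have := compress_defect symX symQ QQ Qfix l m p_sym p_at0 convD pk bk pbk clX pv0.
move/(congr1 (fun t => dotp xi xi * t)); rewrite mulr0 => rel; rewrite -[RHS]rel.
rewrite mulr_sumr; apply: eq_bigr => w _; rewrite mulr_sumr; apply: eq_bigr => i _.
rewrite CQ -scalemxAl mul_xi scalerA dotpZr [in RHS](dotpC _ xi).
by field.
Qed.

End TopRelation.

(** * Vanishing of the top coefficients *)

Section TopCoefficients.
Context {R : realType} {g delta k : nat}.
Variable p : 'M[freepoly R g]_delta.
Let d := mxdeg p.

Hypothesis top_rel : forall (f : seq 'I_g -> 'I_delta -> R) b l m,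
  (d + size b = k.+1 + k.+1)%N ->
  \sum_(w <- mxsupp p | size w == d) \sum_i mxcoef w p l i *
    (f (rev (take (d - k.+1) w) ++ b) m * f (drop (d - k.+1) w) i) = 0.

(** The bilinear form whose diagonal vanishes by [top_rel]. Here [f s i] stands for the pairing of
    [xi] with [s(X)v_i]. *)
Let B (f h : seq 'I_g -> 'I_delta -> R) b l m :=
  \sum_(w <- mxsupp p | size w == d) \sum_i mxcoef w p l i *
    (f (rev (take (d - k.+1) w) ++ b) m * h (drop (d - k.+1) w) i).

Lemma top_rel_polar f h b l m : (d + size b = k.+1 + k.+1)%N ->
  B f h b l m + B h f b l m = 0.
Proof.
move=> db; have := top_rel (fun s i => f s i + h s i) l m db.
have := top_rel f l m db; have := top_rel h l m db.
rewrite -/(B h h b l m) -/(B f f b l m) => Bh Bf sum0.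
transitivity (B f h b l m + B h f b l m + B f f b l m + B h h b l m).
  by rewrite Bf Bh !addr0.
rewrite -[RHS]sum0 /B -!big_split /=.
apply: eq_bigr => w _; rewrite -!big_split /=; apply: eq_bigr => i _; ring.
Qed.

Let delta_word (s0 : seq 'I_g) i0 (s : seq 'I_g) (i : 'I_delta) : R :=
  ((s == s0) && (i == i0))%:R.

(** The reversed prefix followed by [b] and the suffix together determine [w], so two delta
    functions single out one coefficient. *)
Lemma B_delta (w0 : {fmonom 'I_g}) b l m i0 : w0 \in mxsupp p -> size w0 = d ->
  B (delta_word (rev (take (d - k.+1) w0) ++ b) m) (delta_word (drop (d - k.+1) w0) i0) b l m =
  mxcoef w0 p l i0.
Proof.
move=> w0p w0d; rewrite /B big_mkcond (bigD1_seq w0) ?fset_uniq //= w0d eqxx.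
rewrite [X in _ + X]big1 ?addr0 => [|w ww0].
  rewrite (bigD1 i0) //= big1 ?addr0 => [|i /negPf ii0].
    by rewrite /delta_word !eqxx !mulr1.
  by rewrite /delta_word ii0 andbF mulr0n !mulr0.
case: eqP => // wd; rewrite big1 // => i _; rewrite /delta_word.
case: eqP => [/eqP|_]; last by rewrite /= mulr0n mul0r mulr0.
rewrite eqseq_cat; last by rewrite !size_rev !size_take wd w0d.
rewrite (inj_eq (can_inj revK)) => /andP[/eqP tw _].
case: (drop _ w =P _) => [dw|_]; last by rewrite /= mulr0n !mulr0.
case/eqP: ww0; apply/eqP; rewrite fmP.
by rewrite -(cat_take_drop (d - k.+1) w) -[X in _ == X](cat_take_drop (d - k.+1) w0) tw dw.
Qed.

(** With [u] the reversed prefix and [r] the suffix of [w0], the coefficient is [B] at the deltas of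
    [u ++ b] and [r]. By polarisation it is minus the swapped term, to which a word can contribute
    only if [r] ends in [b]. Choosing [b] different from the tail of [r] gives zero. *)
Lemma top_coef0 : (k.+1 <= d)%N -> (d < k.+1 + k.+1)%N ->
  forall w : {fmonom 'I_g}, w \in mxsupp p -> size w <> d.
Proof.
move=> kd dk w0 w0p w0d.
have : mxcoef w0 p != 0 by rewrite -mem_mxsupp.
case/eqP; apply/matrixP => l i0; rewrite [RHS]mxE.
pose u := rev (take (d - k.+1) w0); pose r := drop (d - k.+1) w0.
have su : size u = (d - k.+1)%N by rewrite size_rev size_take_min w0d; lia.
have sr : size r = k.+1 by rewrite size_drop w0d; lia.
pose beta := (k.+1 + k.+1 - d)%N.
have db b : size b = beta -> (d + size b = k.+1 + k.+1)%N by rewrite /beta; lia.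
have sb : size (drop (d - k.+1) r) = beta by rewrite [LHS]size_drop sr /beta; lia.
have [[b [bb ub]]|no_b] := pselect (exists b, size b = beta /\ drop (d - k.+1) r <> b).
  rewrite -(B_delta b l i0 i0 w0p w0d).
  rewrite -[RHS](top_rel_polar (delta_word (u ++ b) i0) (delta_word r i0) l i0 (db _ b bb)).
  rewrite -[LHS]addr0; congr (_ + _); apply/esym; rewrite /B big1 // => w /eqP wd.
  rewrite big1 // => i _; rewrite {1}/delta_word.
  case: (_ ++ _ =P r) => [wr|_]; last by rewrite /= mulr0n mul0r mulr0.
  by case: ub; rewrite -wr drop_size_cat // size_rev size_take_min wd; lia.
(* Without such a [b] there is only one letter, since each constant word of length [beta > 0] equals
   the tail of [r]. Then [u ++ b] and [r] coincide, and [top_rel] itself gives the coefficient. *)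
have rub : r = u ++ drop (d - k.+1) r.
  have letters_eq (i j : 'I_g) : i = j.
    have nseq_eq (a : 'I_g) : drop (d - k.+1) r = nseq beta a.
      by apply: contrapT => ra; apply: no_b; exists (nseq beta a); rewrite size_nseq.
    have beta_gt0 : (0 < beta)%N by rewrite /beta; lia.
    have := nseq_eq i; rewrite (nseq_eq j).
    by case: (beta) beta_gt0 => // m _ [].
  have i1 : 'I_g by case: (r) sr.
  apply: (@eq_from_nth _ i1); first by rewrite size_cat su sb sr /beta; lia.
  by move=> *; exact: letters_eq.
rewrite -(B_delta (drop (d - k.+1) r) l i0 i0 w0p w0d) -/u -/r -rub.
exact: top_rel (db _ _ sb).
Qed.

End TopCoefficients.

(** * Boundary points at which evaluation is injective *)

Section Evaluations.
Context {R : realType} {g delta : nat}.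
Variable N : nat.

Local Notation wordidx := (N.-bseq 'I_g * 'I_delta)%type.

(** Multiplying by a row of coefficients on the left computes [q(X)v] up to transposition, so
    [row_free] means that [q |-> q(X)v] is injective in degree at most [N]. *)
Definition eval_mx {n} (X : 'I_g -> 'M[R]_n) (v : 'cV[R]_(delta * n)) :
    'M[R]_(#|{: wordidx}|, n) :=
  \matrix_(i, j) (let sl : wordidx := enum_val i in
    eval_seq X sl.1 *m tens_comp v sl.2) j 0.

Definition row_of_coefs (c : 'rV[R]_#|{: wordidx}|) : 'rV[freepoly R g]_delta :=
  \row_l \sum_(s : N.-bseq 'I_g) << c 0 (enum_rank (s, l)) *g FMonom s >>.

Lemma mcoeff_row_of_coefs c l (s : N.-bseq 'I_g) :
  (row_of_coefs c 0 l)@_(FMonom s) = c 0 (enum_rank (s, l)).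
Proof.
rewrite mxE raddf_sum /= (bigD1 s) //= mcoeffUU big1 ?addr0 // => t ts.
rewrite mcoeffU (_ : FMonom t == FMonom s = false) ?mulr0n //.
by rewrite fmP /= val_eqE (negPf ts).
Qed.

Lemma mcoeff_row_of_coefs_big c l (w : {fmonom 'I_g}) : (N < size w)%N ->
  (row_of_coefs c 0 l)@_w = 0.
Proof.
move=> Nw; rewrite mxE raddf_sum big1 //= => s _.
rewrite mcoeffU; case: eqP => [sw|]; rewrite ?mulr0n //.
by have := size_bseq s; rewrite -sw /= in Nw *; rewrite leqNgt Nw.
Qed.

Lemma row_of_coefs_neq0 c : c != 0 -> row_of_coefs c != 0.
Proof.
apply: contra => /eqP/matrixP c0; apply/eqP/rowP => i; rewrite mxE.
rewrite -(enum_valK i); case: (enum_val i) => s l.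
by rewrite -mcoeff_row_of_coefs c0 mxE mcoeff0.
Qed.

Lemma mxdeg_row_of_coefs c : (mxdeg (row_of_coefs c) <= N)%N.
Proof.
apply/mxdeg_leP => w; rewrite mem_mxsupp leqNgt; apply: contra => Nw.
by apply/eqP/matrixP => i j; rewrite [LHS]mxE [RHS]mxE (ord1 i) mcoeff_row_of_coefs_big.
Qed.

Lemma row_apply_row_of_coefs c n (X : 'I_g -> 'M[R]_n) (v : 'cV_(delta * n)) :
  row_apply (row_of_coefs c) X v = (c *m eval_mx X v)^T.
Proof.
rewrite row_apply_act /mx_act exchange_big /=.
transitivity (\sum_l \sum_(s : N.-bseq 'I_g)
    c 0 (enum_rank (s, l)) *: (eval_seq X s *m tens_comp v l)).
  apply: eq_bigr => l _.
  transitivity (\sum_(w <- mxsupp (row_of_coefs c)) \sum_(s : N.-bseq 'I_g)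
     (c 0 (enum_rank (s, l)) *+ (FMonom s == w)) *: (eval_seq X s *m tens_comp v l)).
    apply: eq_bigr => w _; rewrite !mxE raddf_sum scaler_suml; apply: eq_bigr => s _ /=.
    by rewrite mcoeffU; case: eqP => [<-|_] //; rewrite mulr0n !scale0r.
  rewrite exchange_big; apply: eq_bigr => s _ /=.
  have [supp_s|] := boolP (FMonom s \in mxsupp (row_of_coefs c)).
    rewrite (bigD1_seq (FMonom s)) ?fset_uniq //= big1 ?addr0 ?eqxx ?mulr1n //.
    by move=> w ws; rewrite eq_sym (negPf ws) mulr0n scale0r.
  rewrite mem_mxsupp negbK => /eqP/matrixP/(_ 0 l).
  rewrite mxE mcoeff_row_of_coefs mxE => ->.
  by rewrite scale0r big1 // => w _; rewrite mul0rn scale0r.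
rewrite exchange_big pair_big /=; apply/colP => j; rewrite summxE !mxE.
rewrite (reindex (@enum_val _ {: wordidx})) /=; last first.
  by exists enum_rank => i _; rewrite (enum_valK, enum_rankK).
by apply: eq_bigr => i _; rewrite !mxE -surjective_pairing enum_valK.
Qed.

Lemma eval_mx_dsum m n (X : 'I_g -> 'M[R]_m) (Y : 'I_g -> 'M[R]_n) v u :
  eval_mx (dsum_tuple X Y) (tens_vec (fun l => col_mx (tens_comp v l) (tens_comp u l))) =
  row_mx (eval_mx X v) (eval_mx Y u).
Proof.
apply/matrixP => i j; rewrite mxE /= tens_vecK eval_seq_dsum mul_block_col.
rewrite !mul0mx addr0 add0r; case: (split_ordP j) => k ->.
  by rewrite col_mxEu row_mxEl [RHS]mxE.
by rewrite col_mxEd row_mxEr [RHS]mxE.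
Qed.

(** [c] is in the left kernel of [A] but not in that of [row_mx A C], so the latter is strictly
    smaller. *)
Lemma rank_row_mx_lt m n1 n2 (A : 'M[R]_(m, n1)) (C : 'M[R]_(m, n2)) (c : 'rV_m) :
  c *m A = 0 -> c *m C != 0 -> (\rank A < \rank (row_mx A C))%N.
Proof.
move=> cA cC.
have sub : (kermx (row_mx A C) <= kermx A)%MS.
  apply/sub_kermxP; have /(congr1 lsubmx) := mulmx_ker (row_mx A C).
  by rewrite mul_mx_row row_mxKl linear0.
have lt_ker : (\rank (kermx (row_mx A C)) < \rank (kermx A))%N.
  rewrite ltn_neqAle mxrankS // andbT; apply: contra cC => eq_rank.
  have [_] := mxrank_leqif_sup sub; rewrite eq_rank => /esym ker_sub.
  have : (c <= kermx (row_mx A C))%MS.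
    by apply: submx_trans ker_sub; apply/sub_kermxP.
  by move/sub_kermxP/(congr1 rsubmx); rewrite mul_mx_row row_mxKr linear0 => ->.
have := rank_leq_row A; have := rank_leq_row (row_mx A C).
by rewrite !mxrank_ker in lt_ker; lia.
Qed.

Variable p : 'M[freepoly R g]_delta.
Hypothesis p_at0 : mxcoef (FMonom [::]) p = 1%:M.

Lemma detailed_boundary_dsum m n X v Y u :
  detailed_boundary p m (X, v) -> detailed_boundary p n (Y, u) ->
  detailed_boundary p (m + n) (dsum_tuple X Y,
    tens_vec (fun l => col_mx (tens_comp v l) (tens_comp u l))).
Proof.
move=> /(detailed_boundaryP p)[symX clX v0 pv].
move=> /(detailed_boundaryP p)[symY clY u0 pu].
apply/(detailed_boundaryP p); split.
- by move=> j; rewrite /dsum_tuple tr_block_mx symX symY !trmx0.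
- exact: closure_domain_dsum.
- apply: contra v0 => /eqP vu0; apply/eqP/tens_compP => l.
  have := congr1 (fun x => usubmx (tens_comp x l)) vu0.
  by rewrite tens_vecK col_mxKu !tens_comp0 linear0.
- apply: tens_compP => l; rewrite tens_comp_mxeval tens_vecK mx_act_dsum.
  by rewrite -!tens_comp_mxeval pv pu !tens_comp0 col_mx0.
Qed.

(** While the rows of [eval_mx X v] are dependent, a relation [c] among them is a non-zero row
    polynomial, which fails to vanish at some boundary point; adding that point as a direct summand
    raises the rank. *)
Lemma dominating_point : (0 < delta)%N ->
  (forall q : 'rV[freepoly R g]_delta, q != 0 -> (mxdeg q <= N)%N ->
     ~ vanishes_on_boundary p q) ->
  exists n (X : 'I_g -> 'M[R]_n) (v : 'cV[R]_(delta * n)),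
    detailed_boundary p n (X, v) /\ row_free (eval_mx X v).
Proof.
move=> delta_gt0 no_q.
have sep (c : 'rV[R]_#|{: wordidx}|) : c != 0 ->
    exists n (X : 'I_g -> 'M[R]_n) (v : 'cV[R]_(delta * n)),
    detailed_boundary p n (X, v) /\ c *m eval_mx X v != 0.
  move=> c0; apply: contrapT => none.
  apply: (no_q _ (row_of_coefs_neq0 c0) (mxdeg_row_of_coefs c)) => n X v Xv.
  rewrite row_apply_row_of_coefs.
  have [->|cE] := eqVneq (c *m eval_mx X v) 0; first by rewrite trmx0.
  by case: none; exists n, X, v.
suff : forall r, (r <= #|{: wordidx}|)%N ->
    exists n (X : 'I_g -> 'M[R]_n) (v : 'cV[R]_(delta * n)),
    detailed_boundary p n (X, v) /\ (r <= \rank (eval_mx X v))%N.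
  move=> /(_ _ (leqnn _))[n [X [v [Xv rk]]]]; exists n, X, v; split => //.
  by rewrite /row_free eqn_leq rank_leq_row.
elim=> [_|r IH lt_r].
  (* Even rank 0 requires some boundary point; non-vanishing of the row [const_mx 1] provides
     one. *)
  have [|n [X [v [Xv _]]]] := sep (const_mx 1); last by exists n, X, v.
  apply/eqP => /rowP/(_ (enum_rank (@Bseq N _ [::] isT, Ordinal delta_gt0)))/eqP.
  by rewrite !mxE oner_eq0.
have [n [X [v [Xv le_r]]]] := IH (ltnW lt_r).
have [lt_rk|] := ltnP r (\rank (eval_mx X v)); first by exists n, X, v.
move=> rk_le.
have : ~~ row_free (eval_mx X v) by rewrite /row_free neq_ltn (leq_ltn_trans rk_le lt_r).
rewrite -kermx_eq0 => /rowV0Pn[c /sub_kermxP cX c0].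
have [m [Y [u [Yu cY]]]] := sep c c0.
exists (n + m)%N, (dsum_tuple X Y).
exists (tens_vec (fun l => col_mx (tens_comp v l) (tens_comp u l))).
split; first exact: detailed_boundary_dsum.
by rewrite eval_mx_dsum (leq_ltn_trans le_r) // (rank_row_mx_lt cX cY).
Qed.

(** Independent rows make the linear system for [xi] solvable for every right-hand side. *)
Lemma dual_vector n (X : 'I_g -> 'M[R]_n) v (f : seq 'I_g -> 'I_delta -> R) :
  row_free (eval_mx X v) ->
  exists xi : 'cV[R]_n, forall s l, (size s <= N)%N ->
    dotp xi (eval_seq X s *m tens_comp v l) = f s l.
Proof.
move=> freeX.
pose F : 'cV[R]_#|{: wordidx}| := \col_i (let sl : wordidx := enum_val i in f sl.1 sl.2).
exists (pinvmx (eval_mx X v) *m F) => s l sN.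
have EF : eval_mx X v *m (pinvmx (eval_mx X v) *m F) = F.
  by rewrite mulmxA mulmxVp // mul1mx.
have sl_rank : enum_val (enum_rank (Bseq sN, l)) = (Bseq sN, l) by rewrite enum_rankK.
transitivity (F (enum_rank (Bseq sN, l)) 0); last by rewrite mxE sl_rank.
rewrite -[in RHS]EF dotpC dotpE [RHS]mxE; apply: eq_bigr => i _.
by rewrite [in RHS]mxE sl_rank.
Qed.

End Evaluations.

(** * The two ranges of the degree, and the theorem *)

(** The witness is a row of [p] itself, non-zero because [p(0) = 1]. *)
Lemma low_degree_vanishing (R : realType) (g delta : nat)
    (p : 'M[{malg R[{fmonom 'I_g}]}]_delta) :
  (0 < delta)%N -> mxcoef (FMonom [::]) p = 1%:M ->
  exists q : 'rV[{malg R[{fmonom 'I_g}]}]_delta,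
    [/\ q != 0, (mxdeg q <= mxdeg p)%N & vanishes_on_boundary p q].
Proof.
move=> delta_gt0 p_at0; pose l := Ordinal delta_gt0.
have coef_row w m : mxcoef w (row l p) 0 m = mxcoef w p l m by rewrite !mxE.
have sub_supp : (mxsupp (row l p) `<=` mxsupp p)%fset.
  apply/fsubsetP => w; rewrite !mem_mxsupp; apply: contra => /eqP/matrixP pw.
  by apply/eqP/matrixP => i m; rewrite (ord1 i) coef_row pw !mxE.
exists (row l p); split.
- apply/eqP => /rowP/(_ l)/(congr1 (mcoeff (FMonom [::]))).
  move/matrixP/(_ l l): p_at0; rewrite !mxE eqxx mcoeff0 => -> /eqP.
  by rewrite oner_eq0.
- by apply/mxdeg_leP => w /(fsubsetP sub_supp); exact: size_mxsupp.
- move=> n X v [_ _ /(congr1 (fun x => tens_comp x l))].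
  rewrite tens_comp_mxeval tens_comp0 => pv0; rewrite -[RHS]pv0 row_apply_act.
  rewrite /mx_act (big_fset_incl _ sub_supp) /=.
    by apply: eq_bigr => w _; apply: eq_bigr => m _; rewrite coef_row.
  move=> w _; rewrite mem_mxsupp negbK => /eqP w0.
  by rewrite big1 // => m _; rewrite w0 mxE scale0r.
Qed.

Lemma high_degree_vanishing (R : realType) (g delta : nat)
    (p : 'M[{malg R[{fmonom 'I_g}]}]_delta) :
  (0 < delta)%N -> fpmx_inv p = p -> domain_convex p ->
  mxcoef (FMonom [::]) p = 1%:M -> (2 < mxdeg p)%N ->
  exists q : 'rV[{malg R[{fmonom 'I_g}]}]_delta,
    [/\ q != 0, (mxdeg q <= (mxdeg p)./2.+1)%N & vanishes_on_boundary p q].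
Proof.
move=> delta_gt0 p_sym convD p_at0 d_gt2; apply: contrapT => none.
set d := mxdeg p in d_gt2 none *; pose k := d./2.
have dk : d = (odd d + k.*2)%N by rewrite odd_double_half.
have [|n [X [v [Xv freeX]]]] := @dominating_point R g delta k.+1 p p_at0 delta_gt0.
  by move=> q q0 qd qvan; apply: none; exists q.
move/(detailed_boundaryP p): Xv => [symX clX _ pv].
have pv0 l : mx_act p X (tens_comp v) l = 0.
  by rewrite -tens_comp_mxeval pv tens_comp0.
have odd_le1 : (odd d <= 1)%N by case: (odd d).
have k_gt0 : (0 < k)%N by lia.
have top_lt : forall w : {fmonom 'I_g}, w \in mxsupp p -> size w <> d.
  apply: (@top_coef0 _ _ _ k); [|by rewrite -/d; lia..].
  move=> f b l m db; rewrite -/d in db *.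
  (* Prescribing zero off length [k.+1] makes [xi] orthogonal to all [s(X)v_i] with
     [size s <= k]. *)
  have [xi xiP] := dual_vector (fun s l => if size s == k.+1 then f s l else 0) freeX.
  have xi_low s i : (size s <= k)%N -> dotp xi (eval_seq X s *m tens_comp v i) = 0.
    by move=> sk; rewrite xiP ?leqW //; case: eqP => // ek; move: sk; rewrite ek ltnn.
  have pk : (mxdeg p <= k + k.+1)%N by rewrite -/d; lia.
  (* [size b] is 2 for even [d] and 1 for odd [d], so [d > 2] is exactly what bounds it by [k]. *)
  have bk : (size b <= k)%N by lia.
  rewrite -[RHS](top_relation l m symX p_sym p_at0 convD pk bk db clX pv0 xi_low).
  apply: eq_bigr => w /eqP wd; apply: eq_bigr => i _; rewrite -/d.
  have su : size (rev (take (d - k.+1) w) ++ b) = k.+1.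
    by rewrite size_cat size_rev size_take_min wd; lia.
  have sr : size (drop (d - k.+1) w) = k.+1 by rewrite size_drop wd; lia.
  by rewrite !xiP ?su ?sr ?eqxx.
have : (d <= d.-1)%N.
  apply/mxdeg_leP => w0 w0p; have := size_mxsupp w0p; have := top_lt w0 w0p.
  by rewrite -/d; move: (size w0) => sw; lia.
by lia.
Qed.

Theorem theorem8p3 (R : realType) (g delta d : nat)
    (p : 'M[{malg R[{fmonom 'I_g}]}]_delta)
    (g_gt0 : (0 < g)%N) (delta_gt0 : (0 < delta)%N)
    (p_sym : fpmx_inv p = p) (p_deg : mxdeg p = d)
    (Dp_bounded : domain_bounded p) (Dp_convex : domain_convex p)
    (p_at0 : mxcoef (FMonom [::]) p = 1%:M) :
  (exists q : 'rV[{malg R[{fmonom 'I_g}]}]_delta,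
     [/\ q != 0, (mxdeg q <= d./2 + 1)%N & vanishes_on_boundary p q]) /\
  (minimum_degree p -> (d <= 2)%N).
Proof.
subst d; have [d_le2|d_gt2] := leqP (mxdeg p) 2.
  (* A row of [p] has low enough degree, since [d <= d./2 + 1] for [d <= 2]. *)
  split=> //; have [q [q0 qd qvan]] := low_degree_vanishing delta_gt0 p_at0.
  by exists q; split => //; apply: leq_trans qd _; lia.
have [q [q0 qd qvan]] := high_degree_vanishing delta_gt0 p_sym Dp_convex p_at0 d_gt2.
split; first by exists q; rewrite addn1.
(* For [d > 2] one has [d./2.+1 < d], so minimality would force [q = 0]. *)
move=> min_p; case/eqP: q0; apply: min_p qvan; apply: leq_ltn_trans qd _; lia.
Qed.
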